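(* For positive integers $k<n$, $\alpha(\Gamma_{k,n})\ge k!\,(n-k)!$ and $\chi(\Gamma_{k,n})\le\binom{n}{k}$.
   Context: $S_n$ is the symmetric group on $[n]=\{1,\dots,n\}$. For $\sigma\in S_n$, $\sigma_{(k)}$ denotes the induced permutation of the set of $k$-element subsets of $[n]$, $\sigma_{(k)}(\{a_1,\dots,a_k\})=\{\sigma(a_1),\dots,\sigma(a_k)\}$; $\sigma$ is a $k$-derangement if $\sigma_{(k)}$ fixes no $k$-element subset. Let $\mathcal{D}_{k,n}$ be the set of $k$-derangements in $S_n$. The $k$-derangement graph $\Gamma_{k,n}$ is the Cayley graph $\Gamma(S_n,\mathcal{D}_{k,n})$: vertices are the elements of $S_n$, and $u,v$ are adjacent iff $su=v$ for some $s\in\mathcal{D}_{k,n}$. $\alpha(G)$ is the independence number and $\chi(G)$ the chromatic number of $G$. *)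

(* Defs.v *)
From mathcomp Require Import all_boot all_fingroup.

Set Implicit Arguments.
Unset Strict Implicit.
Unset Printing Implicit Defensive.

Section GraphParameters.
Variables (T : finType) (e : rel T).

Definition independent (A : {set T}) : bool :=
  [forall x in A, forall y in A, ~~ e x y].

Definition independence_number : nat :=
  \max_(A : {set T} | independent A) #|A|.

Definition proper_coloring (c : nat) (f : {ffun T -> 'I_c}) : bool :=
  [forall x, forall y, e x y ==> (f x != f y)].

Definition colorable (c : nat) : bool :=
  [exists f : {ffun T -> 'I_c}, proper_coloring f].

(* The least c such that e is c-colorable. The search can stop at #|T|, which
   suffices for every loopless e (see chromatic_numberP); it would return
   #|T|.+1 if e had a loop. *)
Definition chromatic_number : nat := find colorable (iota 0 #|T|.+1).

Lemma chromatic_numberP : irreflexive e ->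
  colorable chromatic_number /\
  (forall c, colorable c -> chromatic_number <= c).
Proof.
move=> e_irr.
have colT : colorable #|T|.
  apply/existsP; exists [ffun x => enum_rank x].
  apply/forallP=> x; apply/forallP=> y; apply/implyP=> exy; rewrite !ffunE.
  by apply: contraTN exy => /eqP/enum_rank_inj->; rewrite e_irr.
have hasT : has colorable (iota 0 #|T|.+1).
  by apply/hasP; exists #|T|; rewrite // mem_iota add0n leqnn.
split.
  have := nth_find 0 hasT; rewrite nth_iota ?add0n //.
  by rewrite has_find size_iota in hasT.
move=> c colc; rewrite leqNgt; apply/negP=> ltc.
have := before_find 0 ltc; rewrite nth_iota ?add0n ?colc //.
by apply: leq_trans ltc _; rewrite -[X in _ <= X](size_iota 0) find_size.
Qed.

End GraphParameters.

Definition kderangement (k n : nat) (s : 'S_n) : bool :=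
  [forall A : {set 'I_n}, (#|A| == k) ==> (s @: A != A)].

Definition kderangements (k n : nat) : {set 'S_n} :=
  [set s : 'S_n | kderangement k s].

(* The product of permutations in mathcomp is (u * s) x = s (u x), so u * s is
   the product su in the convention where permutations compose from right to
   left. *)
Definition kderangement_graph (k n : nat) : rel 'S_n :=
  [rel u v | [exists s in kderangements k n, (u * s)%g == v]].
Arguments kderangement_graph : clear implicits.

Lemma kderangement_graph_sym (k n : nat) : symmetric (kderangement_graph k n).
Proof.
suff H (u v : 'S_n) : kderangement_graph k n u v -> kderangement_graph k n v u.
  by move=> u v; apply/idP/idP; apply: H.
case/existsP=> s /andP[]; rewrite inE => /forallP ds /eqP<-.
apply/existsP; exists s^-1%g; rewrite mulgK eqxx andbT inE.
apply/forallP=> A; apply/implyP=> cA; apply: contraNN (implyP (ds A) cA).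
move=> /eqP {1}<-; apply/eqP; rewrite -imset_comp -[RHS]imset_id.
by apply: eq_imset => x /=; rewrite permKV.
Qed.

Lemma kderangement_graph_irr (k n : nat) :
  k <= n -> irreflexive (kderangement_graph k n).
Proof.
move=> le_kn u; apply/negbTE/existsP=> -[s /andP[]]; rewrite inE => /forallP ds.
move=> /eqP us; have s1 : s = 1%g by apply: (mulgI u); rewrite us mulg1.
have [A /andP[_ cA]] : exists A : {set 'I_n}, (A \subset [set: 'I_n]) && (#|A| == k).
  have : 0 < #|[set A : {set 'I_n} | A \subset [set: 'I_n] & #|A| == k]|.
    by rewrite cards_draws cardsT card_ord bin_gt0.
  by case/card_gt0P=> A; rewrite inE; exists A.
move: (implyP (ds A) cA); rewrite s1 => /eqP[].
by rewrite -[RHS]imset_id; apply: eq_imset => x; rewrite perm1.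
Qed.

(* Main.v *)
Require Import Defs.
From mathcomp Require Import all_boot all_fingroup.

(** Fix a [k]-subset [A] and colour a permutation [u] by the [k]-subset [u @: A].
    Adjacent permutations differ by a [k]-derangement, which moves [u @: A], so
    this is a proper colouring with ['C(n, k)] colours.  Its largest colour class
    is independent and has at least [n`! / 'C(n, k) = k`! * (n - k)`!] elements. *)

(** Numbering the elements of [B] turns colours in [B] into colours in ['I_#|B|]. *)
Lemma colorable_card (T U : finType) (e : rel T) (B : {set U}) (f : T -> U) :
  (forall x, f x \in B) -> (forall x y, e x y -> f x != f y) ->
  colorable e #|B|.
Proof.
move=> fB fP; apply/existsP.
exists [ffun x => enum_rank_in (fB x) (f x)].
apply/forallP=> x; apply/forallP=> y; apply/implyP=> /fP; rewrite !ffunE.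
apply: contraNN => /eqP /(congr1 enum_val).
by rewrite !enum_rankK_in // => ->.
Qed.

(** The [c] colour classes partition [T], and each is independent. *)
Lemma card_le_colorable (T : finType) (e : rel T) (c : nat) :
  colorable e c -> #|T| <= c * independence_number e.
Proof.
case/existsP=> f /forallP fP.
rewrite -sum1_card (partition_big f xpredT) //=.
rewrite -[X in X * _](card_ord c) -sum_nat_const; apply: leq_sum => i _.
have -> : \sum_(x | f x == i) 1 = #|[set x | f x == i]|.
  by rewrite sum1dep_card.
apply: (leq_bigmax_cond (F := fun A : {set T} => #|A|)).
apply/forall_inP=> x; rewrite inE => /eqP fx.
apply/forall_inP=> y; rewrite inE => /eqP fy.
by apply: contraTN (forallP (fP x) y); rewrite fx fy eqxx implybF negbK.
Qed.

Lemma kderangement_graph_colorable (k n : nat) :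
  k <= n -> colorable (kderangement_graph k n) 'C(n, k).
Proof.
move=> le_kn; set B := [set A : {set 'I_n} | #|A| == k].
have cardB : #|B| = 'C(n, k) by rewrite card_draws card_ord.
have /card_gt0P[A] : 0 < #|B| by rewrite cardB bin_gt0.
rewrite inE => /eqP cA; rewrite -cardB.
apply: (@colorable_card _ _ _ _ (fun u : 'S_n => u @: A)) => [u | u v].
  by rewrite inE card_imset ?cA //; apply: perm_inj.
case/existsP=> s /andP[]; rewrite inE => /forallP ds /eqP <-.
have -> : (u * s)%g @: A = s @: (u @: A).
  by rewrite -imset_comp; apply: eq_imset => x; rewrite permM.
(* [u @: A] is again a [k]-subset, so the [k]-derangement [s] moves it. *)
rewrite eq_sym (implyP (ds _)) // card_imset ?cA //; apply: perm_inj.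
Qed.

Theorem theorem4 (k n : nat) (k_gt0 : 0 < k) (k_lt_n : k < n) :
  k`! * (n - k)`! <= independence_number (kderangement_graph k n) /\
  chromatic_number (kderangement_graph k n) <= 'C(n, k).
Proof.
have le_kn := ltnW k_lt_n.
have col := kderangement_graph_colorable _ _ le_kn.
split; last first.
  by case: (chromatic_numberP (kderangement_graph_irr le_kn)) => _; apply.
have bin_pos : 0 < 'C(n, k) by rewrite bin_gt0.
rewrite -(leq_pmul2l bin_pos) bin_fact // -card_Sn.
by apply: leq_trans (card_le_colorable _ _ _ col); rewrite max_card.
Qed.
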